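(* Let $0<\alpha \le 1/6$ and let $\mathsf{Halver}$ be a data-oblivious $\alpha$-halver procedure operating on pairs of equal-sized arrays whose size is a power of $2$. Then the procedure $\mathsf{Reduce}$ (defined in the context, built from $\mathsf{Halver}$), applied to pairs of arrays of size a power of $2$, is a $(\delta,5/6)$-attenuator for every $\delta$ satisfying $\delta \ge \alpha + \alpha\delta + \delta^2$.
   Context: A compare-exchange on positions $(p,q)$ replaces the values $(x,y)$ there by $(\min(x,y),\max(x,y))$; a procedure is data-oblivious if its sequence of compare-exchanges/memory accesses is independent of the input values. For $\epsilon\ge0$, an $\epsilon$-halver is a data-oblivious procedure that, given arrays $(A,B)$ each of size $n$, performs compare-exchanges so that afterwards, for every $k\le n$, at most $\epsilon k$ of the $k$ largest elements of $A\cup B$ are in $A$ and at most $\epsilon k$ of the $k$ smallest are in $B$. For $\delta\ge 0$ and $0<\lambda<1$, a $(\delta,\lambda)$-attenuator is a data-oblivious procedure taking arrays $(A,B)$ each of size $n$ such that, for every $k\le \lambda n$: if initially $k_1$ of the $k$ largest elements of $A\cup B$ are in $A$ and $k_2$ of the $k$ smallest are in $B$, then afterwards at most $\delta k_1$ of the $k$ largest elements are in $A$ and at most $\delta k_2$ of the $k$ smallest are in $B$. ''Sort $A\cup B$'' means rearranging the $2n$ items so that the concatenation $AB$ is in nondecreasing order; ''partition $E$ into halves $F,G$'' means viewing the first half of subarray $E$ as $F$ and the second half as $G$ (no data movement). Procedure $\mathsf{Attenuate}(A,B)$, with $|A|=|B|=n$ a power of 2: if $n\le 8$, sort $A\cup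 B$ and return. Otherwise partition $A$ into halves $A_1,A_2$ and $B$ into halves $B_1,B_2$; run $\mathsf{Halver}(A_1,A_2)$, $\mathsf{Halver}(B_1,B_2)$, $\mathsf{Halver}(A_2,B_1)$, then $\mathsf{Attenuate}(A_2,B_1)$; then partition $A_2$ into halves $A_{21},A_{22}$ and $B_1$ into halves $B_{11},B_{12}$; run $\mathsf{Halver}(A_{21},A_{22})$, $\mathsf{Halver}(B_{11},B_{12})$, $\mathsf{Halver}(A_{22},B_{11})$, then $\mathsf{Attenuate}(A_{22},B_{11})$. Procedure $\mathsf{Reduce}(A,B)$: if $n\le 8$, sort $A\cup B$ and return; otherwise run $\mathsf{Halver}(A,B)$ and then $\mathsf{Attenuate}(A,B)$.
   Formalization: Compare-exchanges on (p,q) are taken with p < q in the concatenation AB (minimum to the earlier position); if reversed compare-exchanges are allowed, an α-halver can move large items from B into A and the claim fails with k_1 = 0. *)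

(* Defs.v *)
From HB Require Import structures.
From mathcomp Require Import all_boot all_order all_algebra.

Set Implicit Arguments.
Unset Strict Implicit.
Unset Printing Implicit Defensive.

Import Order.TTheory GRing.Theory Num.Theory.

Local Open Scope order_scope.

Section Networks.
Variables (d : Order.disp_t) (T : orderType d).

Definition compare_exchange (N : nat) (t : N.-tuple T) (pq : 'I_N * 'I_N) :
    N.-tuple T :=
  let x := tnth t pq.1 in
  let y := tnth t pq.2 in
  [tuple if i == pq.1 then Order.min x y
         else if i == pq.2 then Order.max x y
         else tnth t i | i < N].

Definition run (N : nat) (c : seq ('I_N * 'I_N)) (t : N.-tuple T) :
    N.-tuple T :=
  foldl (@compare_exchange N) t c.

Definition procedure := seq T -> seq T -> seq T * seq T.

(* The array pair (A, B) is laid out as the concatenation AB.  Comparators are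
   oriented as usual in comparator networks: p < q, so the minimum goes to the
   position that comes first in AB.  In particular no comparator can increase
   the number of large items in A; the bounds relative to k1 and k2 in
   [attenuator] below rely on this.  The sequence c depends on the size n but
   not on the values. *)
Definition data_oblivious (n : nat) (P : procedure) : Prop :=
  exists c : seq ('I_(n + n) * 'I_(n + n)),
    all (fun pq : 'I_(n + n) * 'I_(n + n) => (pq.1 < pq.2)%N) c /\
    forall A B : n.-tuple T,
      let AB := run c [tuple of A ++ B] in
      P A B = (take n AB, drop n AB).

(* As sets of items, these are meaningful for duplicate-free s. *)
Definition largest (k : nat) (s : seq T) : seq T := take k (sort >=%O s).
Definition smallest (k : nat) (s : seq T) : seq T := take k (sort <=%O s).

Definition halves (s : seq T) : seq T * seq T :=
  (take (size s)./2 s, drop (size s)./2 s).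

Definition sort_pair : procedure := fun A B =>
  let AB := sort <=%O (A ++ B) in (take (size A) AB, drop (size A) AB).

Section Reduce.
Variable Halver : procedure.

(* attenuate m and reduce m act on pairs of arrays of size 2 ^ m; the last
   branch of the match is never reached, since there 2 ^ m <= 8. *)
Fixpoint attenuate (m : nat) (A B : seq T) : seq T * seq T :=
  if (2 ^ m <= 8)%N then sort_pair A B else
  match m with
  | (m2.+1 as m1).+1 =>
      let: (A1, A2) := halves A in
      let: (B1, B2) := halves B in
      let: (A1, A2) := Halver A1 A2 in
      let: (B1, B2) := Halver B1 B2 in
      let: (A2, B1) := Halver A2 B1 in
      let: (A2, B1) := attenuate m1 A2 B1 in
      let: (A21, A22) := halves A2 in
      let: (B11, B12) := halves B1 in
      let: (A21, A22) := Halver A21 A22 in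
      let: (B11, B12) := Halver B11 B12 in
      let: (A22, B11) := Halver A22 B11 in
      let: (A22, B11) := attenuate m2 A22 B11 in
      (A1 ++ (A21 ++ A22), (B11 ++ B12) ++ B2)
  | _ => (A, B)
  end.

Definition reduce (m : nat) : procedure := fun A B =>
  if (2 ^ m <= 8)%N then sort_pair A B else
  let: (A, B) := Halver A B in attenuate m A B.

End Reduce.

Local Open Scope ring_scope.

Variable R : realFieldType.

(* In both definitions the 2n items are pairwise distinct, so that "the k
   largest (smallest) items" is unambiguous. *)
Definition halver (n : nat) (eps : R) (P : procedure) : Prop :=
  [/\ 0 <= eps,
      data_oblivious n P &
      forall (A B : n.-tuple T) (k : nat),
        uniq (A ++ B) -> (k <= n)%N ->
        let: (A', B') := P A B in
        (count [in largest k (A ++ B)] A')%:R <= eps * k%:R /\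
        (count [in smallest k (A ++ B)] B')%:R <= eps * k%:R].

Definition attenuator (n : nat) (delta lambda : R) (P : procedure) : Prop :=
  [/\ 0 <= delta,
      0 < lambda < 1,
      data_oblivious n P &
      forall (A B : n.-tuple T) (k : nat),
        uniq (A ++ B) -> k%:R <= lambda * n%:R ->
        let k1 := count [in largest k (A ++ B)] A in
        let k2 := count [in smallest k (A ++ B)] B in
        let: (A', B') := P A B in
        (count [in largest k (A ++ B)] A')%:R <= delta * k1%:R /\
        (count [in smallest k (A ++ B)] B')%:R <= delta * k2%:R].

End Networks.

(* Main.v *)
(* Call an item big if it is among the k <= 5n/6 largest.  Comparators oriented
   towards B never increase the number a of big items in A, and after the first
   halver a <= alpha k <= 5n/36.  Halving A and B leaves at most alpha a big
   items in A1, and so few in A2 and B1 together that A2 u B1 satisfies the 5/6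
   bound at size n/2; by induction at most delta a of them remain in A2.
   Likewise at most alpha delta a end up in A21, and, by induction at size n/4,
   at most delta^2 a in A22, for a total of
   (alpha + alpha delta + delta^2) a <= delta a.  The 5/6 bound for
   the recursive calls needs an upper bound on the big items in B1 also when B contains more
   than n/2 of them: then the other items of B are its smallest ones and the
   halver puts at most a fraction alpha of these into B2. *)
Require Import Defs.
From HB Require Import structures.
From mathcomp Require Import all_boot all_order all_algebra.
From mathcomp Require Import zify lra.

Set Implicit Arguments.
Unset Strict Implicit.
Unset Printing Implicit Defensive.

Import Order.TTheory GRing.Theory Num.Theory.
Local Open Scope ring_scope.

(** * Arithmetic of the item counts *)

Section Counts.
Variables (R : realFieldType) (alpha delta : R).

(** Rearranged, the hypothesis reads [delta * (1 - alpha) >= alpha + delta ^+ 2], whose right side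
    is positive. *)
Lemma delta_gt0 :
  0 < alpha <= 1 / 6 -> delta >= alpha + alpha * delta + delta ^+ 2 ->
  0 < delta.
Proof.
move=> alpha_bnd delta_bnd; case/andP: (alpha_bnd) => a0 a6.
have := sqr_ge0 delta => h.
have : 0 < delta * (1 - alpha) by lra.
by rewrite pmulr_lgt0 //; lra.
Qed.

Lemma delta_lt1 :
  0 < alpha <= 1 / 6 -> delta >= alpha + alpha * delta + delta ^+ 2 ->
  delta < 1.
Proof.
move=> alpha_bnd delta_bnd; case/andP: (alpha_bnd) => a0 a6.
have d0 := delta_gt0 alpha_bnd delta_bnd.
have : 0 < delta * (1 - delta) by nra.
by rewrite pmulr_rgt0 // subr_gt0.
Qed.

(* u, v (u', v') count the items of interest in the two arrays of size n before
   (after) a procedure that should move them to the second array.  The last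
   condition is the halver bound for the n + n - (u + v) other items. *)
Definition halved (n u v u' v' : R) : Prop :=
  [/\ u' + v' = u + v, u' <= u, [/\ 0 <= u', 0 <= v' & v' <= n],
      u + v <= n -> u' <= alpha * (u + v) &
      n <= u + v -> n - v' <= alpha * (2 * n - (u + v))].

Definition attenuated (n u v u' v' : R) : Prop :=
  [/\ u' + v' = u + v, 0 <= u', 0 <= v' &
      u + v <= 5 / 6 * n -> u' <= delta * u].

Lemma alphaM_le (x : R) : 0 < alpha <= 1 / 6 -> 0 <= x -> alpha * x <= x / 6.
Proof. by case/andP => a0 a6 x0; nra. Qed.

(** The two cases of [halved], with [alpha] weakened to 1/6 so that later goals become linear. In
    the second, the items overfill the second array: the excess [u + v - n] must stay behind, and
    each foreign item kept there displaces one more. *)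
Lemma halved_le (n u v u' v' : R) :
  0 < alpha <= 1 / 6 -> halved n u v u' v' -> u + v <= 2 * n ->
  u' <= (u + v) / 6 \/ u' <= u + v - n + (2 * n - (u + v)) / 6.
Proof.
move=> alpha_bnd [uv _ [u'0 v'0 _] hs hl] le2.
case: (lerP (u + v) n) => [/hs ?|/ltW/hl ?].
  left; have : alpha * (u + v) <= (u + v) / 6 by (apply: alphaM_le => //; lra).
  by lra.
right; have : alpha * (2 * n - (u + v)) <= (2 * n - (u + v)) / 6.
  by apply: alphaM_le => //; lra.
by lra.
Qed.

(** One level of the recursion at size [4 * q], seen only through counts: [x], [y] belong to the
    halves of A and B, [z], [w] to the halves of A2 and B1 after the first recursive call. One prime
    marks the state after a halver, two primes the state after a recursive call together with the
    halver before it. *)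
Lemma attenuated_zigzag (q a0 b0 a b x1 x2 y1 y2 x1' x2' y1' y2' : R)
    (x2'' y1'' z1 z2 w1 w2 z1' z2' w1' w2' z2'' w1'' u' v' : R) :
  0 < alpha <= 1 / 6 ->
  delta >= alpha + alpha * delta + delta ^+ 2 ->
  0 <= q ->
  halved (4 * q) a0 b0 a b -> a = x1 + x2 -> b = y1 + y2 ->
  halved (2 * q) x1 x2 x1' x2' -> halved (2 * q) y1 y2 y1' y2' ->
  attenuated (2 * q) x2' y1' x2'' y1'' -> x2'' = z1 + z2 -> y1'' = w1 + w2 ->
  halved q z1 z2 z1' z2' -> halved q w1 w2 w1' w2' ->
  attenuated q z2' w1' z2'' w1'' ->
  u' = x1' + z1' + z2'' -> v' = w1'' + w2' + y2' ->
  attenuated (4 * q) a0 b0 u' v'.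
Proof.
move=> alpha_bnd delta_bnd; have d0 := delta_gt0 alpha_bnd delta_bnd.
have d1 := delta_lt1 alpha_bnd delta_bnd.
case/andP: (alpha_bnd) => al0 al6.
move=> q0 [ab aa0 [age0 bge0 bleq] abs _] ax by_.
move=> [x12 _ [x1'0 x2'0 _] xs _] hy.
have [y12 _ [y1'0 y2'0 _] _ _] := hy.
move=> [xy2 x2''0 y1''0 xyd] xz yw.
move=> [z12 _ [z1'0 z2'0 _] zs _] hw.
have [w12 _ [w1'0 w2'0 _] _ _] := hw.
move=> [zw2 z2''0 w1''0 zwd] u'E v'E.
split; [lra|lra|lra|move=> T56].
have T0 : 0 <= a0 + b0 by lra.
have aT : a <= (a0 + b0) / 6.
  by apply: le_trans (alphaM_le alpha_bnd T0); apply: abs; lra.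
have x1a : x1' <= alpha * a by rewrite ax; apply: xs; lra.
(* Here [x2' <= a <= 5q/9]. The worst case is the overfull one, where the sum is at most
   [a + 5b/6 - 4q/3 <= 83q/54], just below [5q/3]. *)
have K2 : x2' + y1' <= 5 / 6 * (2 * q).
  by case: (halved_le alpha_bnd hy); lra.
have x2d := xyd K2.
(* [attenuated] records no monotonicity; it comes from [delta < 1]. *)
have x2''le : x2'' <= x2' by apply: le_trans x2d _; nra.
have z1a : z1' <= alpha * x2'' by rewrite xz; apply: zs; lra.
(* Now [x2'' <= 5q/9] and [x2'' + y1'' <= 5q/3]; in the overfull case the sum is at most
   [x2'' + 5 y1''/6 - 2q/3 <= 22q/27]. *)
have K3 : z2' + w1' <= 5 / 6 * q.
  by case: (halved_le alpha_bnd hw); lra.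
have z2d := zwd K3.
have z2le : delta * z2' <= delta * x2'' by rewrite ler_pM2l //; lra.
have adx : (alpha + delta) * x2'' <= (alpha + delta) * (delta * a).
  rewrite ler_pM2l ?addr_gt0 //; apply: le_trans x2d _.
  by rewrite ler_pM2l //; lra.
have da : (alpha + alpha * delta + delta ^+ 2) * a <= delta * a.
  by apply: ler_wpM2r.
have daa : delta * a <= delta * a0 by rewrite ler_pM2l.
by lra.
Qed.
End Counts.

(** * Effect of comparators on up-closed sets *)

Section Networks.
Variables (d : Order.disp_t) (T : orderType d).
Implicit Types (s : seq T) (A B : seq T) (p : pred T) (P : procedure T).
Local Open Scope nat_scope.
Local Open Scope order_scope.

(** Such predicates stand in for the k largest or smallest items: a single one restricts to every
    subarray and selects the largest or smallest items there too, with k varying. *)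
Definition upper p := forall x y : T, x <= y -> p x -> p y.
Definition lower p := forall x y : T, x <= y -> p y -> p x.

Lemma lowerC p : lower p -> upper (predC p).
Proof. by move=> lp x y xy /=; apply: contra; apply: lp. Qed.

Lemma upperC p : upper p -> lower (predC p).
Proof. by move=> lp x y xy /=; apply: contra; apply: lp. Qed.

Lemma count_take_sum {S : Type} (a : pred S) (t : seq S) (x0 : S) j :
  count a (take j t) = (\sum_(i < size t) ((i < j)%N && a (nth x0 t i)))%N.
Proof.
elim: t j => [|x t IH] [|j] /=.
- by rewrite big_ord0.
- by rewrite big_ord0.
- by rewrite big1.
by rewrite big_ord_recl /= IH.
Qed.

Lemma count_take_tnth {S : Type} {N} (a : pred S) (t : N.-tuple S) j :
  count a (take j t) = (\sum_(i < N) ((i < j)%N && a (tnth t i)))%N.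
Proof.
case: N t => [|N] t; first by rewrite (tuple0 t) big_ord0 take_oversize.
rewrite (count_take_sum _ _ (tnth t ord0)) size_tuple.
by apply: eq_bigr => i _; rewrite [in RHS](tnth_nth (tnth t ord0)).
Qed.

Lemma count_takeD2 {N} (p q : 'I_N) (t : N.-tuple T) (a : pred T) j :
  q != p ->
  count a (take j t) =
  (((p < j) && a (tnth t p)) + ((q < j) && a (tnth t q)) +
   \sum_(i < N | (i != p) && (i != q)) ((i < j) && a (tnth t i)))%N.
Proof.
by move=> qp; rewrite count_take_tnth (bigD1 p) //= (bigD1 q) //= addnA.
Qed.

(** Only two positions change. A prefix containing the later one contains the earlier one, which
    receives the minimum, and the minimum lies in an up-closed set only if the maximum does. Prefix
    length [n] will give monotonicity in A, full length the permutation property. *)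
Lemma count_compare_exchange {N} (t : N.-tuple T) (pq : 'I_N * 'I_N)
    (a : pred T) j :
  (pq.1 < pq.2)%N ->
  (upper a ->
     (count a (take j (compare_exchange t pq)) <= count a (take j t))%N) /\
  ((N <= j)%N ->
     count a (take j (compare_exchange t pq)) = count a (take j t)).
Proof.
case: pq => p q ltpq; rewrite /= in ltpq.
have neq : q != p by rewrite neq_ltn ltpq orbT.
rewrite !(count_takeD2 _ _ _ neq) //.
rewrite !tnth_mktuple /= !eqxx (negPf neq).
under eq_bigr => i /andP[ip iq] do rewrite tnth_mktuple (negPf ip) (negPf iq).
rewrite leq_add2r; split=> [ua|lej]; last first.
  rewrite !(leq_trans (ltn_ord _) lej) /=; congr (_ + _)%N.
  by case: leP => // _; rewrite addnC.
case: leP => // /ltW /ua h.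
have [|_] := boolP (q < j)%N.
  by move=> /(ltn_trans ltpq) -> /=; rewrite addnC.
by rewrite !addn0; case: (p < j)%N => //=; move: h; do 2![case: (a _)] => // ->.
Qed.

Lemma count_run_take {N} (c : seq ('I_N * 'I_N)) (t : N.-tuple T) a j :
  all (fun pq : 'I_N * 'I_N => (pq.1 < pq.2)%N) c -> upper a ->
  (count a (take j (run c t)) <= count a (take j t))%N.
Proof.
move=> cW ua; elim: c t cW => //= pq c IH t /andP[pqW cW].
apply: leq_trans (IH _ cW) _.
by case: (count_compare_exchange t a j pqW) => + _; apply.
Qed.

Lemma perm_run {N} (c : seq ('I_N * 'I_N)) (t : N.-tuple T) :
  all (fun pq : 'I_N * 'I_N => (pq.1 < pq.2)%N) c -> perm_eq (run c t) t.
Proof.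
elim: c t => //= pq c IH t /andP[pqW cW].
apply: perm_trans (IH _ cW) _; apply/permP => a.
have [_ /(_ (leqnn N))] := count_compare_exchange t a N pqW.
by rewrite !take_oversize ?size_tuple.
Qed.

(** * Comparator networks as functions on sequences, closed under composition and action on a
    block *)

Definition computed N (f : seq T -> seq T) : Prop :=
  exists2 c : seq ('I_N * 'I_N),
    all (fun pq : 'I_N * 'I_N => (pq.1 < pq.2)%N) c &
    forall t : N.-tuple T, f t = run c t.

Lemma eq_computed N f g :
  (forall s, size s = N -> f s = g s) -> computed N f -> computed N g.
Proof. by move=> fg [c cW cE]; exists c => // t; rewrite -fg ?size_tuple. Qed.

Lemma computed_id N : computed N id.
Proof. by exists [::]. Qed.

Lemma computed_comp N f g : computed N f -> computed N g -> computed N (g \o f).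
Proof.
move=> [c cW cE] [c' cW' cE']; exists (c ++ c'); first by rewrite all_cat cW.
by move=> t /=; rewrite cE cE' /run foldl_cat.
Qed.

Definition on_block i n (f : seq T -> seq T) s :=
  take i s ++ f (take n (drop i s)) ++ drop (i + n) s.

Lemma on_block_cat i n f u v w : size u = i -> size v = n ->
  on_block i n f (u ++ v ++ w) = u ++ f v ++ w.
Proof.
move=> <- <-; rewrite /on_block take_size_cat // drop_size_cat //.
by rewrite take_size_cat // addnC -drop_drop !drop_size_cat.
Qed.

Lemma compare_exchange_block i n r (u : i.-tuple T) (v : n.-tuple T)
    (w : r.-tuple T) (p q : 'I_n) :
  compare_exchange [tuple of u ++ [tuple of v ++ w]]
    (rshift i (lshift r p), rshift i (lshift r q)) =
  [tuple of u ++ [tuple of compare_exchange v (p, q) ++ w]].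
Proof.
apply: eq_from_tnth => j; rewrite tnth_mktuple /= !(tnth_rshift, tnth_lshift).
case: (split_ordP j) => {}j ->; first by rewrite !eq_lrshift !tnth_lshift.
rewrite !eq_rshift !tnth_rshift; case: (split_ordP j) => {}j ->.
  by rewrite !eq_lshift !tnth_lshift tnth_mktuple.
by rewrite !eq_rlshift !tnth_rshift.
Qed.

Lemma computed_block N i n r f : N = (i + (n + r))%N ->
  computed n f -> computed N (on_block i n f).
Proof.
move=> -> [c cW cE].
pose h (k : 'I_n) : 'I_(i + (n + r)) := rshift i (lshift r k).
exists [seq (h pq.1, h pq.2) | pq <- c].
  by rewrite all_map; apply: sub_all cW => pq /=; rewrite ltn_add2l.
move=> t.
have sz1 : size (take i t) == i by rewrite size_takel // size_tuple leq_addr.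
have sz2 : size (take n (drop i t)) == n.
  by rewrite size_takel // size_drop size_tuple addKn leq_addr.
have sz3 : size (drop (i + n) t) == r.
  by rewrite size_drop size_tuple addnA addKn.
pose u := Tuple sz1; pose v := Tuple sz2; pose w := Tuple sz3.
have -> : t = [tuple of u ++ [tuple of v ++ w]].
  have dropE : drop (i + n) t = drop n (drop i t).
    by rewrite drop_drop; congr drop; apply: addnC.
  by apply: val_inj; rewrite /= dropE !cat_take_drop.
rewrite /= on_block_cat ?(eqP sz1) ?(eqP sz2) // -[take n _]/(val v) cE.
elim: c {cW cE} (v) => /= [|[p q] c IH] {}v; first by [].
by rewrite IH compare_exchange_block.
Qed.

(** * Sorting by a comparator network *)

Lemma computed_compare2 :
  computed 2 (fun s => if s is [:: x; y] then [:: Order.min x y; Order.max x y]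
                       else s).
Proof.
exists [:: (ord0, ord_max)] => //= t.
case/tupleP: t => x t; case/tupleP: t => y t; rewrite (tuple0 t) /=.
by rewrite !enum_ordSl enum_ord0.
Qed.

(* [bubble x s] is one pass of adjacent comparators over x :: s; it inserts x
   into s when s is sorted. *)
Fixpoint bubble x s : seq T :=
  if s is y :: s' then Order.min x y :: bubble (Order.max x y) s' else [:: x].

Definition bubble_head s := if s is x :: s' then bubble x s' else [::].

(** A pass is one comparator on the first two positions, then a pass over everything but the first
    position. *)
Lemma computed_bubble N : computed N bubble_head.
Proof.
case: N => [|N].
  by apply: eq_computed (computed_id 0) => s /size0nil ->.
elim: N => [|N IH].
  by apply: eq_computed (computed_id 1) => -[|x []].
have h1 := @computed_block N.+2 0 2 N _ erefl computed_compare2.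
have h2 := @computed_block N.+2 1 N.+1 0 _ (esym (congr1 S (addn0 _))) IH.
apply: eq_computed (computed_comp h1 h2) => -[|x [|y s]] //= [sz].
by rewrite /on_block /= !take0 !drop0 /= take_oversize ?sz // drop_oversize ?sz
  ?cats0 //.
Qed.

Lemma perm_bubble x s : perm_eq (bubble x s) (x :: s).
Proof.
elim: s x => //= y s IH x.
rewrite -[x :: y :: s]/([:: x; y] ++ s) -[_ :: bubble _ _]cat1s.
apply: perm_trans (perm_cat (perm_refl _) (IH _)) _ => /=.
case: leP => // _.
exact: (introT permPl (perm_catCA [:: y] [:: x] s)).
Qed.

Lemma path_bubble z x s : z <= x -> path <=%O z s -> path <=%O z (bubble x s).
Proof.
elim: s z x => /= [|y s IH] z x zx; first by rewrite zx.
case/andP=> zy ys; rewrite le_min zx zy /=.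
apply: IH; first by rewrite ge_min le_max lexx.
by apply: path_le ys; [exact: le_trans | rewrite ge_min lexx orbT].
Qed.

Lemma sorted_bubble x s : sorted <=%O s -> sorted <=%O (bubble x s).
Proof.
case: s => //= y s ys; apply: path_bubble; first by rewrite ge_min le_max lexx.
by apply: path_le ys; [exact: le_trans | rewrite ge_min lexx orbT].
Qed.

(** Insertion sort: sort the tail, then bubble the head into it. The result agrees with [sort]
    because a sorted permutation is unique. *)
Lemma computed_sort N : computed N (sort <=%O).
Proof.
elim: N => [|N IH].
  by apply: eq_computed (computed_id 0) => s /size0nil ->.
have h1 := @computed_block N.+1 1 N 0 _ (esym (congr1 S (addn0 _))) IH.
apply: eq_computed (computed_comp h1 (computed_bubble _)) => -[//|x s] [sz].
rewrite /= /on_block /= take0 drop0 /= take_oversize ?sz //.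
rewrite drop_oversize ?sz // cats0; apply: (sorted_eq le_trans le_anti).
- exact/sorted_bubble/sort_le_sorted.
- exact: sort_le_sorted.
apply: perm_trans (perm_bubble _ _) _.
by rewrite perm_sym perm_sort perm_cons perm_sym perm_sort.
Qed.

(** * Data-oblivious procedures on pairs of arrays *)

Definition concat_run n P s := let: (A, B) := P (take n s) (drop n s) in A ++ B.

(** Moves between pairs and concatenated arrays, where networks compose. The size condition says
    where to cut the concatenation to recover the pair. *)
Lemma data_obliviousP n P :
  data_oblivious n P <->
  computed (n + n) (concat_run n P) /\
  forall A B, size A = n -> size B = n -> size (P A B).1 = n.
Proof.
split=> [[c [cW cE]]|[[c cW cE] szP]].
  split=> [|A B /eqP szA /eqP szB]; last first.
    by rewrite (cE (Tuple szA) (Tuple szB)) /= size_takel //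
      size_tuple leq_addr.
  exists c => // t.
  have sz1 : size (take n t) == n by rewrite size_takel // size_tuple leq_addr.
  have sz2 : size (drop n t) == n by rewrite size_drop size_tuple addKn.
  rewrite /concat_run (cE (Tuple sz1) (Tuple sz2)) /= cat_take_drop.
  by congr (tval (run c _)); apply: val_inj; rewrite /= cat_take_drop.
exists c; split=> // A B /=.
have := szP A B (size_tuple _) (size_tuple _); have := cE [tuple of A ++ B].
rewrite /concat_run /= take_size_cat ?size_tuple //.
rewrite drop_size_cat ?size_tuple //.
by case: (P A B) => A' B' /= <- sz; rewrite take_size_cat // drop_size_cat.
Qed.

Lemma data_oblivious_spec n P A B A' B' :
  data_oblivious n P -> size A = n -> size B = n -> P A B = (A', B') ->
  [/\ size A' = n, size B' = n, perm_eq (A' ++ B') (A ++ B) &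
      forall p, upper p -> (count p A' <= count p A)%N].
Proof.
move=> [c [cW cE]] /eqP szA /eqP szB.
rewrite (cE (Tuple szA) (Tuple szB)) /= => -[<- <-]; split.
- by rewrite size_takel // size_tuple leq_addr.
- by rewrite size_drop size_tuple addKn.
- by rewrite cat_take_drop; apply: perm_run.
- move=> p up; apply: leq_trans (count_run_take _ _ cW up) _.
  by rewrite /= take_size_cat ?(eqP szA).
Qed.

Lemma data_oblivious_sort_pair n : data_oblivious n (@sort_pair d T).
Proof.
apply/data_obliviousP; split=> [|A B szA szB].
  apply: eq_computed (computed_sort _) => s sz.
  by rewrite /concat_run /= !cat_take_drop.
by rewrite /= size_takel // size_sort size_cat szA leq_addr.
Qed.

Lemma eq_data_oblivious n P Q :
  (forall A B, P A B = Q A B) -> data_oblivious n P -> data_oblivious n Q.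
Proof. by move=> PQ [c [cW cE]]; exists c; split=> // A B; rewrite -PQ. Qed.

(** * Translation between the k extreme items and closed predicates *)

Lemma take_count_sorted (r : rel T) p s :
  transitive r -> (forall x y, r x y -> p y -> p x) -> sorted r s ->
  take (count p s) s = filter p s.
Proof.
move=> tr dp; elim: s => //= x s IH xs.
have [px|npx] /= := boolP (p x); first by rewrite add0n IH // (path_sorted xs).
have np : ~~ has p s.
  apply/hasPn => y ys; apply: contra npx; apply: dp.
  by move: xs; rewrite path_sortedE // => /andP[/allP /(_ _ ys)].
rewrite add0n; have := np; rewrite has_count -leqNgt leqn0 => /eqP ->.
by move: np; rewrite has_filter negbK => /eqP ->.
Qed.

Lemma mem_take_sort (r : rel T) p s :
  transitive r -> total r -> (forall x y, r x y -> p y -> p x) ->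
  take (count p s) (sort r s) =i [predI p & mem s].
Proof.
move=> tr tt dp x; rewrite -(count_sort r) (@take_count_sorted r) //.
  by rewrite mem_filter inE mem_sort.
exact: sort_sorted.
Qed.

(** With k chosen as the number of items satisfying an up-closed [p], the k largest items are
    exactly these; this lets the halver bound be applied to predicates. *)
Lemma count_largest p s s' : upper p -> {subset s' <= s} ->
  count [in largest (count p s) s] s' = count p s'.
Proof.
move=> up ss; apply: eq_in_count => x /ss xs.
rewrite /= mem_take_sort; first by rewrite inE /= xs andbT.
- exact: ge_trans.
- exact: ge_total.
- by move=> y z zy; apply: up.
Qed.

Lemma count_smallest p s s' : lower p -> {subset s' <= s} ->
  count [in smallest (count p s) s] s' = count p s'.
Proof.
move=> lp ss; apply: eq_in_count => x /ss xs.
rewrite /= mem_take_sort; first by rewrite inE /= xs andbT.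
- exact: le_trans.
- exact: le_total.
- by move=> y z zy; apply: lp.
Qed.

(* The k first items of s form an initial segment of s but not of T; [has (r z)]
   is the closure that does so without changing anything on s. *)
Lemma initial_closure (r : rel T) s k :
  transitive r -> total r -> antisymmetric r -> reflexive r ->
  {in s, (fun z => has (r z) (take k (sort r s))) =1 [in take k (sort r s)]}.
Proof.
move=> tr tt ar rr z zs /=; apply/idP/idP; last first.
  by move=> zt; apply/hasP; exists z.
case/hasP=> w wt zw.
have := zs; rewrite -(mem_sort r) -{1}(cat_take_drop k (sort r s)) mem_cat.
case/orP=> // zd; have := sort_sorted tt s.
rewrite sorted_pairwise // -{1}(cat_take_drop k (sort r s)) pairwise_cat.
case/andP=> /allrelP /(_ _ _ wt zd) wz _.
by rewrite (ar z w) // zw wz.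
Qed.

Lemma count_take_le (r : rel T) k s : uniq s ->
  (count [in take k (sort r s)] s <= k)%N.
Proof.
move=> U; apply: leq_trans (geq_minl k (size (sort r s))).
rewrite -size_take_min -size_filter uniq_leq_size ?filter_uniq // => x.
by rewrite mem_filter => /andP[].
Qed.

(** The opposite passage to [count_largest], for turning bounds on predicates into the attenuator
    property. *)
Lemma upper_largest k s : uniq s -> exists p,
  [/\ upper p, {in s, p =1 [in largest k s]} & (count p s <= k)%N].
Proof.
move=> U; have pE := @initial_closure _ s k ge_trans ge_total ge_anti ge_refl.
exists (fun z => has (fun w => w <= z) (largest k s)); split=> //.
  move=> x y xy /hasP[w wl wx]; apply/hasP.
  by exists w => //; apply: le_trans xy.
by rewrite (eq_in_count pE) count_take_le.
Qed.

Lemma lower_smallest k s : uniq s -> exists p,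
  [/\ lower p, {in s, p =1 [in smallest k s]} & (count p s <= k)%N].
Proof.
move=> U; have pE := @initial_closure _ s k le_trans le_total le_anti le_refl.
exists (fun z => has (fun w => z <= w) (smallest k s)); split=> //.
  move=> x y xy /hasP[w wl wx]; apply/hasP.
  by exists w => //; apply: le_trans wx.
by rewrite (eq_in_count pE) count_take_le.
Qed.

(** * Bounds for halvers and for sorting, on both sides *)

Section Sides.
Variable R : realFieldType.
Local Notation cnt p s := ((count p s)%:R : R)%R.
Local Open Scope ring_scope.

(* The items that must leave A are the large ones, and, with the roles of
   A and B exchanged, those that must leave B are the small ones. *)
Definition both_sides (Q : R -> R -> R -> R -> Prop) A B A' B' :=
  (forall p, upper p -> Q (cnt p A) (cnt p B) (cnt p A') (cnt p B')) /\
  (forall p, lower p -> Q (cnt p B) (cnt p A) (cnt p B') (cnt p A')).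

(** [halved] is self-dual: counting the other items and exchanging the arrays swaps its last two
    conditions. This yields the down-closed case from the up-closed one. *)
Lemma halved_compl (alpha n u v u' v' : R) : u' <= n ->
  halved alpha n u v u' v' -> halved alpha n (n - v) (n - u) (n - v') (n - u').
Proof.
move=> u'n [uv u'u [u'0 v'0 v'n] hs hl]; split; [lra|lra|split; lra| |] => h.
  have -> : n - v + (n - u) = 2 * n - (u + v) by lra.
  by apply: hl; lra.
have -> : 2 * n - (n - v + (n - u)) = u + v by lra.
have -> : n - (n - u') = u' by lra.
by apply: hs; lra.
Qed.

(** If at most n items satisfy an up-closed predicate, the halver bound on the largest items
    applies; if at least n do, its bound on the smallest items applies to the complement. *)
Lemma halver_spec (alpha : R) n P A B A' B' :
  halver n alpha P -> size A = n -> size B = n -> P A B = (A', B') ->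
  [/\ size A' = n, size B' = n, perm_eq (A' ++ B') (A ++ B) &
      uniq (A ++ B) -> both_sides (halved alpha n%:R) A B A' B'].
Proof.
move=> [_ oP hP] szA szB E.
have [szA' szB' pe mono] := data_oblivious_spec oP szA szB E.
split=> // U.
have {}hP k : (k <= n)%N ->
    cnt [in largest k (A ++ B)] A' <= alpha * k%:R /\
    cnt [in smallest k (A ++ B)] B' <= alpha * k%:R.
  move=> kn; have eA := introT eqP szA; have eB := introT eqP szB.
  by have := hP (Tuple eA) (Tuple eB) k U kn; rewrite /= E.
have cAB p : (count p A' + count p B' = count p A + count p B)%N.
  by rewrite -!count_cat; apply/permP.
have subA' : {subset A' <= A ++ B}.
  by move=> x xA; rewrite -(perm_mem pe) mem_cat xA.
have subB' : {subset B' <= A ++ B}.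
  by move=> x xA; rewrite -(perm_mem pe) mem_cat xA orbT.
have cntC p s : size s = n -> cnt p s = n%:R - cnt (predC p) s.
  by move=> <-; rewrite -(count_predC p s) natrD addrK.
have cnt_le p s : size s = n -> cnt p s <= n%:R.
  by move=> <-; rewrite ler_nat count_size.
have up p : upper p ->
    halved alpha n%:R (cnt p A) (cnt p B) (cnt p A') (cnt p B').
  move=> upp; split.
  - by rewrite -!natrD cAB.
  - by rewrite ler_nat mono.
  - by split; rewrite ?ler0n ?cnt_le.
  - rewrite -!natrD -count_cat ler_nat => /hP[+ _].
    by rewrite count_largest.
  have -> : 2 * n%:R - (cnt p A + cnt p B) = cnt (predC p) (A ++ B).
    by rewrite (cntC p A) // (cntC p B) // count_cat natrD; lra.
  have -> : n%:R - cnt p B' = cnt (predC p) B' by rewrite (cntC p B') //; lra.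
  move=> nle; have /hP[_] : (count (predC p) (A ++ B) <= n)%N.
    by rewrite -(ler_nat R) count_cat natrD; move: nle;
      rewrite (cntC p A) // (cntC p B) //; lra.
  by rewrite count_smallest //; apply: upperC.
split=> // p /lowerC upp; have := halved_compl (cnt_le _ _ szA') (up _ upp).
by rewrite -!cntC.
Qed.

(** One item of [p] among the first [j] would force all later positions into [p], giving more than
    [size s - j] items. *)
Lemma count_take_sorted0 p s j : upper p -> sorted <=%O s ->
  (count p s + j <= size s)%N -> count p (take j s) = 0%N.
Proof.
move=> up; rewrite sorted_pairwise; last exact: le_trans.
rewrite -{1 2 3}(cat_take_drop j s) pairwise_cat count_cat size_cat.
case/andP=> /allrelP le_td _ szj; apply/eqP; rewrite -leqn0 leqNgt -has_count.
apply/negP => /[dup] /hasP[x xt px]; rewrite has_count => c0.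
have : all p (drop j s) by apply/allP => y yd; apply: up px; apply: le_td.
rewrite all_count => /eqP; have := size_take j s; move: szj.
case: ltnP => h; rewrite ?size_drop; lia.
Qed.

Lemma count_drop_sorted0 p s j : lower p -> sorted <=%O s ->
  (count p s <= j)%N -> count p (drop j s) = 0%N.
Proof.
move=> up; rewrite sorted_pairwise; last exact: le_trans.
rewrite -{1 2}(cat_take_drop j s) pairwise_cat count_cat.
case/andP=> /allrelP le_td _ szj; apply/eqP; rewrite -leqn0 leqNgt -has_count.
apply/negP => /[dup] /hasP[x xd px]; rewrite has_count => c0.
have : count p (take j s) = size (take j s).
  by apply/eqP; rewrite -all_count; apply/allP => y yd;
     apply: up px; apply: le_td.
have : (j < size s)%N.
  by rewrite ltnNge; apply/negP => /drop_oversize d0; rewrite d0 in c0.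
by move=> js; rewrite (size_takel (ltnW js)); lia.
Qed.

(** At most [5n/6 <= n] items are concerned, so sorting leaves none on the wrong side. [A0], [B0]
    allow the comparison to start before a preceding halver. *)
Lemma sort_pair_attenuated (delta : R) n A B A' B' A0 B0 :
  0 <= delta -> size A = n -> size B = n -> perm_eq (A ++ B) (A0 ++ B0) ->
  sort_pair A B = (A', B') ->
  both_sides (attenuated delta n%:R) A0 B0 A' B'.
Proof.
move=> d0 szA szB pe [<- <-]; set s := sort _ _; rewrite szA.
have szs : size s = (n + n)%N by rewrite size_sort size_cat szA szB.
have ss : sorted <=%O s by apply: sort_le_sorted.
have cs p :
    (count p (take n s) + count p (drop n s) = count p A0 + count p B0)%N.
  rewrite -!count_cat cat_take_drop; apply/permP.
  by apply: perm_trans pe; rewrite perm_sort.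
have small p : cnt p A0 + cnt p B0 <= 5 / 6 * n%:R -> (count p s <= n)%N.
  rewrite -natrD -cs -count_cat cat_take_drop -(ler_nat R) => h.
  by apply: le_trans h _; have := ler0n R n; lra.
split=> p hp; split; rewrite ?ler0n //.
- by rewrite -!natrD cs.
- move=> /small h; rewrite count_take_sorted0 ?mulr_ge0 ?ler0n //.
  by rewrite szs leq_add2r.
- by rewrite -!natrD addnC cs addnC.
- by rewrite addrC => /small h; rewrite count_drop_sorted0 ?mulr_ge0 ?ler0n.
Qed.

End Sides.


Lemma on_block_concat_run n P (u w X Y X' Y' : seq T) i s s' :
  size u = i -> size X = n -> size Y = n -> P X Y = (X', Y') ->
  s = u ++ (X ++ Y) ++ w -> s' = u ++ (X' ++ Y') ++ w ->
  on_block i (n + n) (concat_run n P) s = s'.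
Proof.
move=> szu szX szY E -> ->; rewrite on_block_cat ?size_cat ?szX ?szY //.
by rewrite /concat_run take_size_cat // drop_size_cat // E.
Qed.

Lemma uniq_middle (X Y X1 X2 Y1 Y2 : seq T) :
  uniq (X ++ Y) -> perm_eq (X1 ++ X2) X -> perm_eq (Y1 ++ Y2) Y ->
  uniq (X2 ++ Y1).
Proof.
move=> U pX pY; have := perm_uniq (perm_cat pX pY); rewrite U -catA.
by rewrite cat_uniq (catA X2) (cat_uniq (X2 ++ Y1)) => /and3P[_ _ /and3P[]].
Qed.

(** * The recursion *)

Section Attenuation.
Variables (R : realFieldType) (alpha delta : R) (Halver : procedure T).
Local Open Scope ring_scope.
Hypothesis alpha_bnd : 0 < alpha <= 1 / 6.
Hypothesis delta_bnd : delta >= alpha + alpha * delta + delta ^+ 2.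
Hypothesis HalverP : forall m : nat, halver (2 ^ m)%N alpha Halver.

Lemma attenuate_small m A B : (2 ^ m <= 8)%N ->
  attenuate Halver m A B = sort_pair A B.
Proof. by case: m => [|m] h //=; rewrite h. Qed.

(** The induction invariant covers [Halver] followed by [attenuate] on the same pair, as in both
    recursive calls and in [reduce]: the estimate relies on the few misplaced items that this halver
    leaves. *)
Definition attenuates m := forall A B A1 B1 A' B',
  size A = (2 ^ m)%N -> size B = (2 ^ m)%N -> uniq (A ++ B) ->
  Halver A B = (A1, B1) -> attenuate Halver m A1 B1 = (A', B') ->
  both_sides (attenuated delta (2 ^ m)%:R) A B A' B'.

Lemma attenuates_small m : (2 ^ m <= 8)%N -> attenuates m.
Proof.
move=> m8 A B A1 B1 A' B' szA szB _ E.
have [szA1 szB1 pe _] := halver_spec (HalverP m) szA szB E.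
rewrite attenuate_small //; apply: sort_pair_attenuated => //.
exact/ltW/(delta_gt0 alpha_bnd delta_bnd).
Qed.

Definition halve i m :=
  on_block i (2 ^ m + 2 ^ m) (concat_run (2 ^ m) Halver).

Definition atten i m :=
  on_block i (2 ^ m + 2 ^ m) (concat_run (2 ^ m) (attenuate Halver m)).

(* [attenuate m.+2] on the concatenated arrays; the first argument of [halve]
   and [atten] is the offset of the block they act on. *)
Definition zigzag m : seq T -> seq T :=
  let h := (2 ^ m)%N in let l := (2 ^ m.+1)%N in
  atten (l + h) m \o (halve (l + h) m \o (halve (l + l) m \o (halve l m \o
  (atten l m.+1 \o (halve l m.+1 \o (halve (l + l) m.+1 \o halve 0 m.+1)))))).

Lemma computed_zigzag m :
  data_oblivious (2 ^ m) (attenuate Halver m) ->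
  data_oblivious (2 ^ m.+1) (attenuate Halver m.+1) ->
  computed (2 ^ m.+2 + 2 ^ m.+2) (zigzag m).
Proof.
move=> ob0 ob1.
have eN : (2 ^ m.+2 + 2 ^ m.+2)%N = (8 * 2 ^ m)%N by rewrite !expnS; lia.
have el : (2 ^ m.+1)%N = (2 * 2 ^ m)%N by rewrite expnS.
have hv k i r : (2 ^ m.+2 + 2 ^ m.+2 = i + (2 ^ k + 2 ^ k + r))%N ->
    computed (2 ^ m.+2 + 2 ^ m.+2) (halve i k).
  move=> /computed_block; apply.
  by case: (HalverP k) => _ /data_obliviousP[].
have at_ k i r : data_oblivious (2 ^ k) (attenuate Halver k) ->
    (2 ^ m.+2 + 2 ^ m.+2 = i + (2 ^ k + 2 ^ k + r))%N ->
    computed (2 ^ m.+2 + 2 ^ m.+2) (atten i k).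
  by move=> /data_obliviousP[ob _] /computed_block; apply.
rewrite /zigzag.
(* The operations are peeled off from the last to the first; each witness is the length to the right
   of the block, in units of [2 ^ m]. *)
apply: computed_comp; last first.
  by apply: (at_ _ _ (3 * 2 ^ m)%N) => //; rewrite eN el; lia.
apply: computed_comp; last first.
  by apply: (hv _ _ (3 * 2 ^ m)%N); rewrite eN el; lia.
apply: computed_comp; last first.
  by apply: (hv _ _ (2 * 2 ^ m)%N); rewrite eN el; lia.
apply: computed_comp; last first.
  by apply: (hv _ _ (4 * 2 ^ m)%N); rewrite eN el; lia.
apply: computed_comp; last first.
  by apply: (at_ _ _ (2 * 2 ^ m)%N) => //; rewrite eN el; lia.
apply: computed_comp; last first.
  by apply: (hv _ _ (2 * 2 ^ m)%N); rewrite eN el; lia.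
apply: computed_comp; last first.
  by apply: (hv _ _ (0 * 2 ^ m)%N); rewrite eN el; lia.
by apply: (hv _ _ (4 * 2 ^ m)%N); rewrite eN el; lia.
Qed.

Lemma attenuateSS m A B : (8 < 2 ^ m.+2)%N ->
  attenuate Halver m.+2 A B =
      let: (A1, A2) := halves A in
      let: (B1, B2) := halves B in
      let: (A1, A2) := Halver A1 A2 in
      let: (B1, B2) := Halver B1 B2 in
      let: (A2, B1) := Halver A2 B1 in
      let: (A2, B1) := attenuate Halver m.+1 A2 B1 in
      let: (A21, A22) := halves A2 in
      let: (B11, B12) := halves B1 in
      let: (A21, A22) := Halver A21 A22 in
      let: (B11, B12) := Halver B11 B12 in
      let: (A22, B11) := Halver A22 B11 in
      let: (A22, B11) := attenuate Halver m A22 B11 in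
      (A1 ++ (A21 ++ A22), (B11 ++ B12) ++ B2).
Proof. by rewrite ltnNge => /negPf h; rewrite {1}/attenuate -/attenuate h. Qed.

Lemma halvesP n s : size s = (n + n)%N ->
  exists s1 s2,
    [/\ halves s = (s1, s2), s = s1 ++ s2, size s1 = n & size s2 = n].
Proof.
move=> sz; exists (take n s), (drop n s).
rewrite /halves sz addnn doubleK cat_take_drop size_drop sz addnK; split=> //.
by rewrite size_takel // sz leq_addr.
Qed.

(** [A0], [B0] are the arrays before the preceding halver. In the proof the suffix [a] marks arrays
    after the halvers of a level, [b] after the middle halver, [c] after the recursive call; [C] and
    [D] name the halves of [A2c] and [B1c]. *)
Lemma attenuate_step m A B A' B' :
  (8 < 2 ^ m.+2)%N ->
  data_oblivious (2 ^ m) (attenuate Halver m) -> attenuates m ->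
  data_oblivious (2 ^ m.+1) (attenuate Halver m.+1) -> attenuates m.+1 ->
  size A = (2 ^ m.+2)%N -> size B = (2 ^ m.+2)%N ->
  attenuate Halver m.+2 A B = (A', B') ->
  [/\ size A' = (2 ^ m.+2)%N, A' ++ B' = zigzag m (A ++ B) &
      forall A0 B0, uniq (A ++ B) ->
      both_sides (halved alpha (2 ^ m.+2)%:R) A0 B0 A B ->
      both_sides (attenuated delta (2 ^ m.+2)%:R) A0 B0 A' B'].
Proof.
move=> m8 ob0 at0 ob1 at1 szA szB; rewrite attenuateSS //.
have eS k : (2 ^ k.+1 = 2 ^ k + 2 ^ k)%N by rewrite expnS mul2n addnn.
have [A1 [A2 [-> -> szA1 szA2]]] := halvesP (etrans szA (eS _)).
have [B1 [B2 [-> -> szB1 szB2]]] := halvesP (etrans szB (eS _)).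
case EA: (Halver A1 A2) => [A1a A2a].
have [szA1a szA2a pA hA] := halver_spec (HalverP m.+1) szA1 szA2 EA.
case EB: (Halver B1 B2) => [B1a B2a].
have [szB1a szB2a pB hB] := halver_spec (HalverP m.+1) szB1 szB2 EB.
case EM: (Halver A2a B1a) => [A2b B1b].
have [szA2b szB1b pM _] := halver_spec (HalverP m.+1) szA2a szB1a EM.
case EM': (attenuate _ _ A2b B1b) => [A2c B1c].
have [szA2c szB1c pM' _] := data_oblivious_spec ob1 szA2b szB1b EM'.
have [C1 [C2 [-> eA2c szC1 szC2]]] := halvesP (etrans szA2c (eS _)).
have [D1 [D2 [-> eB1c szD1 szD2]]] := halvesP (etrans szB1c (eS _)).
case EC: (Halver C1 C2) => [C1a C2a].
have [szC1a szC2a pC hC] := halver_spec (HalverP m) szC1 szC2 EC.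
case ED: (Halver D1 D2) => [D1a D2a].
have [szD1a szD2a pD hD] := halver_spec (HalverP m) szD1 szD2 ED.
case EN: (Halver C2a D1a) => [C2b D1b].
have [szC2b szD1b pN _] := halver_spec (HalverP m) szC2a szD1a EN.
case EN': (attenuate _ _ C2b D1b) => [C2c D1c].
have [szC2c szD1c pN' _] := data_oblivious_spec ob0 szC2b szD1b EN'.
case=> <- <-; split.
- by rewrite !size_cat szA1a szC1a szC2c (eS m.+1) (eS m).
- rewrite /zigzag /=.
  have -> : halve 0 m.+1 ((A1 ++ A2) ++ B1 ++ B2) =
      (A1a ++ A2a) ++ B1 ++ B2.
    apply: (on_block_concat_run (u := [::]) (w := B1 ++ B2) _ _ _ EA);
    by rewrite ?size_cat ?cats0 -?catA // ?szA1a ?szA2a ?szC1a ?szC2a -?eS.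
  have -> : halve (2 ^ m.+1 + 2 ^ m.+1) m.+1 ((A1a ++ A2a) ++ B1 ++ B2) =
      (A1a ++ A2a) ++ B1a ++ B2a.
    apply: (on_block_concat_run (u := A1a ++ A2a) (w := [::]) _ _ _ EB);
    by rewrite ?size_cat ?cats0 -?catA // ?szA1a ?szA2a ?szC1a ?szC2a -?eS.
  have -> : halve (2 ^ m.+1) m.+1 ((A1a ++ A2a) ++ B1a ++ B2a) =
      (A1a ++ A2b) ++ B1b ++ B2a.
    apply: (on_block_concat_run (u := A1a) (w := B2a) _ _ _ EM);
    by rewrite ?size_cat ?cats0 -?catA // ?szA1a ?szA2a ?szC1a ?szC2a -?eS.
  have -> : atten (2 ^ m.+1) m.+1 ((A1a ++ A2b) ++ B1b ++ B2a) =
      (A1a ++ A2c) ++ B1c ++ B2a.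
    apply: (on_block_concat_run (u := A1a) (w := B2a) _ _ _ EM');
    by rewrite ?size_cat ?cats0 -?catA // ?szA1a ?szA2a ?szC1a ?szC2a -?eS.
  rewrite eA2c eB1c.
  have -> : halve (2 ^ m.+1) m
      ((A1a ++ (C1 ++ C2)) ++ (D1 ++ D2) ++ B2a) =
      (A1a ++ (C1a ++ C2a)) ++ (D1 ++ D2) ++ B2a.
    apply: (on_block_concat_run (u := A1a) (w := (D1 ++ D2) ++ B2a) _ _ _ EC);
    by rewrite ?size_cat ?cats0 -?catA // ?szA1a ?szA2a ?szC1a ?szC2a -?eS.
  have -> : halve (2 ^ m.+1 + 2 ^ m.+1) m
      ((A1a ++ (C1a ++ C2a)) ++ (D1 ++ D2) ++ B2a) =
      (A1a ++ (C1a ++ C2a)) ++ (D1a ++ D2a) ++ B2a.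
    apply: (on_block_concat_run (u := A1a ++ C1a ++ C2a) (w := B2a) _ _ _ ED);
    by rewrite ?size_cat ?cats0 -?catA // ?szA1a ?szA2a ?szC1a ?szC2a -?eS.
  have -> : halve (2 ^ m.+1 + 2 ^ m) m
      ((A1a ++ (C1a ++ C2a)) ++ (D1a ++ D2a) ++ B2a) =
      (A1a ++ (C1a ++ C2b)) ++ (D1b ++ D2a) ++ B2a.
    apply: (on_block_concat_run (u := A1a ++ C1a) (w := D2a ++ B2a) _ _ _ EN);
    by rewrite ?size_cat ?cats0 -?catA // ?szA1a ?szA2a ?szC1a ?szC2a -?eS.
  have -> : atten (2 ^ m.+1 + 2 ^ m) m
      ((A1a ++ (C1a ++ C2b)) ++ (D1b ++ D2a) ++ B2a) =
      (A1a ++ (C1a ++ C2c)) ++ (D1c ++ D2a) ++ B2a.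
    apply: (on_block_concat_run (u := A1a ++ C1a) (w := D2a ++ B2a) _ _ _ EN');
    by rewrite ?size_cat ?cats0 -?catA // ?szA1a ?szA2a ?szC1a ?szC2a -?eS.
  by [].
move=> A0 B0 U h0.
have Um := uniq_middle U pA pB.
(* The invariant absorbs the middle halver, so it leads from [A2a], [B1a] directly to [A2c],
   [B1c]. *)
have hM := at1 _ _ _ _ _ _ szA2a szB1a Um EM EM'.
move: U; rewrite cat_uniq => /and3P[/hA{}hA _ /hB{}hB].
have U2 : uniq (A2c ++ B1c) by rewrite (perm_uniq (perm_trans pM' pM)).
move: (U2); rewrite eA2c eB1c => {}U2.
have Un := uniq_middle U2 pC pD.
have hN := at0 _ _ _ _ _ _ szC2a szD1a Un EN EN'.
move: U2; rewrite cat_uniq => /and3P[/hC{}hC _ /hD{}hD].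
have e4 : (2 ^ m.+2)%:R = 4 * (2 ^ m)%:R :> R.
  by rewrite 2!expnS mulnA natrM.
have e2 : (2 ^ m.+1)%:R = 2 * (2 ^ m)%:R :> R by rewrite expnS natrM.
move: h0 hA hB hM; rewrite e4 e2 eA2c eB1c => h0 hA hB hM.
split=> p hp.
  apply: (attenuated_zigzag alpha_bnd delta_bnd (ler0n _ _) (h0.1 _ hp)
    _ _ (hA.1 _ hp) (hB.1 _ hp)
    (hM.1 _ hp) _ _ (hC.1 _ hp) (hD.1 _ hp) (hN.1 _ hp));
  by rewrite !count_cat !natrD; lra.
(* Mirror image for small items: B2 plays the part of A1, and B1 that of A2. *)
apply: (attenuated_zigzag alpha_bnd delta_bnd (ler0n _ _) (h0.2 _ hp)
  _ _ (hB.2 _ hp) (hA.2 _ hp)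
  (hM.2 _ hp) _ _ (hD.2 _ hp) (hC.2 _ hp) (hN.2 _ hp));
by rewrite !count_cat !natrD; lra.
Qed.

(** Strong induction, as the calls are at [m - 1] and [m - 2]. Obliviousness is proved alongside
    because it supplies sizes and permutations for the recursive calls. *)
Lemma attenuate_correct m :
  data_oblivious (2 ^ m) (attenuate Halver m) /\ attenuates m.
Proof.
elim/ltn_ind: m => m IH.
have [m8|m8] := leqP (2 ^ m) 8.
  split; last exact: attenuates_small.
  apply: eq_data_oblivious (data_oblivious_sort_pair _) => A B.
  by rewrite attenuate_small.
case: m m8 IH => [|[|m]] // m8 IH.
have [ob0 at0] := IH m (leqnSn _); have [ob1 at1] := IH m.+1 (leqnn _).
have step C D C' D' := @attenuate_step m C D C' D' m8 ob0 at0 ob1 at1.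
split.
  apply/data_obliviousP; split=> [|A B szA szB]; last first.
    by case E: attenuate => [A' B']; have [] := step _ _ _ _ szA szB E.
  apply: eq_computed (computed_zigzag ob0 ob1) => s sz.
  rewrite /concat_run; case E: attenuate => [A' B'].
  have [||_ -> _] := step _ _ _ _ _ _ E; rewrite ?cat_take_drop //.
    by rewrite size_takel // sz leq_addr.
  by rewrite size_drop sz addnK.
move=> A B A1 B1 A' B' szA szB U EH EA.
have [szA1 szB1 pe h] := halver_spec (HalverP _) szA szB EH.
have [_ _] := step _ _ _ _ szA1 szB1 EA; apply; last exact: h.
by rewrite (perm_uniq pe).
Qed.

(** * The procedure [reduce] *)

Lemma reduceE m A B : ~~ (2 ^ m <= 8)%N ->
  reduce Halver m A B = let: (A, B) := Halver A B in attenuate Halver m A B.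
Proof. by rewrite /reduce => /negPf ->. Qed.

Lemma data_oblivious_reduce m : data_oblivious (2 ^ m) (reduce Halver m).
Proof.
have [obA _] := attenuate_correct m.
case: (boolP (2 ^ m <= 8)%N) => m8.
  apply: eq_data_oblivious (data_oblivious_sort_pair _) => A B.
  by rewrite /reduce m8.
have [_ obH _] := HalverP m.
apply/data_obliviousP; split=> [|A B szA szB]; last first.
  rewrite reduceE //; case E: (Halver A B) => [A1 B1].
  have [szA1 szB1 _ _] := data_oblivious_spec obH szA szB E.
  by case E1: attenuate => [A2 B2];
    have [] := data_oblivious_spec obA szA1 szB1 E1.
move: obH obA => /data_obliviousP[obH szH] /data_obliviousP[obA _].
apply: eq_computed (computed_comp obH obA) => s sz.
have szt : size (take (2 ^ m) s) = (2 ^ m)%N.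
  by rewrite size_takel // sz leq_addr.
have szd : size (drop (2 ^ m) s) = (2 ^ m)%N by rewrite size_drop sz addnK.
have := szH _ _ szt szd.
rewrite /= /concat_run reduceE //; case: Halver => A1 B1 /= szA1.
by rewrite take_size_cat // drop_size_cat.
Qed.

Lemma reduce_attenuated m A B A' B' :
  size A = (2 ^ m)%N -> size B = (2 ^ m)%N -> uniq (A ++ B) ->
  reduce Halver m A B = (A', B') ->
  both_sides (attenuated delta (2 ^ m)%:R) A B A' B'.
Proof.
move=> szA szB U; case: (boolP (2 ^ m <= 8)%N) => m8.
  rewrite /reduce m8; apply: sort_pair_attenuated => //.
  exact/ltW/(delta_gt0 alpha_bnd delta_bnd).
rewrite reduceE //; case E: (Halver A B) => [A1 B1].
by have [_] := attenuate_correct m; apply.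
Qed.

Lemma attenuator_reduce m : attenuator (2 ^ m) delta (5 / 6) (reduce Halver m).
Proof.
have ob := data_oblivious_reduce m.
split=> //; first exact/ltW/(delta_gt0 alpha_bnd delta_bnd).
  by apply/andP; split; lra.
move=> A B k U kn /=; case E: (reduce _ _ _ _) => [A' B'].
have [_ _ pe _] := data_oblivious_spec ob (size_tuple A) (size_tuple B) E.
have [up lo] := reduce_attenuated (size_tuple A) (size_tuple B) U E.
(* Closed predicates replace the k extreme items; each holds for at most k items, so the 5/6
   condition carries over. *)
have [p [pu pE pk]] := upper_largest k U.
have [q [ql qE qk]] := lower_smallest k U.
have sub (C : seq T) : {subset C <= A' ++ B'} -> {subset C <= A ++ B}.
  by move=> CAB x /CAB; rewrite (perm_mem pe).
have subA : {subset A <= A ++ B} by move=> x xA; rewrite mem_cat xA.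
have subB : {subset B <= A ++ B} by move=> x xB; rewrite mem_cat xB orbT.
have subA' : {subset A' <= A ++ B} by apply: sub => x xA; rewrite mem_cat xA.
have subB' : {subset B' <= A ++ B}.
  by apply: sub => x xB; rewrite mem_cat xB orbT.
have cp (C : seq T) : {subset C <= A ++ B} ->
    count [in largest k (A ++ B)] C = count p C.
  by move=> CAB; apply: eq_in_count => x /CAB xC; rewrite pE.
have cq (C : seq T) : {subset C <= A ++ B} ->
    count [in smallest k (A ++ B)] C = count q C.
  by move=> CAB; apply: eq_in_count => x /CAB xC; rewrite qE.
rewrite !cp // !cq //; split.
  have [_ _ _] := up p pu; apply; apply: le_trans kn.
  by rewrite -natrD ler_nat -count_cat.
have [_ _ _] := lo q ql; apply; apply: le_trans kn.
by rewrite -natrD ler_nat addnC -count_cat.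
Qed.

End Attenuation.

End Networks.

Theorem theorem2 (R : realFieldType) (d : Order.disp_t) (T : orderType d)
    (alpha : R) (Halver : procedure T) :
  0 < alpha <= 1 / 6 ->
  (forall m : nat, halver (2 ^ m)%N alpha Halver) ->
  forall delta : R,
    delta >= alpha + alpha * delta + delta ^+ 2 ->
    forall m : nat, attenuator (2 ^ m)%N delta (5 / 6) (reduce Halver m).
Proof. by move=> al hH delta de m; apply: attenuator_reduce de hH m. Qed.
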